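(* Let $m\in\{1,2,\ldots\}$ and let $\check\rho,\hat\rho>0$ with $\hat\rho=n\check\rho$ for some integer $n\ge 2$. The operators $R:S_{\check\rho}\to S_{\hat\rho}$, $R(M)=B_{\hat\rho/2}(M)\cap\Delta_{\hat\rho}$, and $I:S_{\hat\rho}\to S_{\check\rho}$, $I(M)=B_{\hat\rho/2}(M)\cap\Delta_{\check\rho}$, satisfy: (i) if $\hat\rho/\check\rho\in 2\mathbb{N}_1+1$, then $R(I(\hat M))=\hat M$ for all $\hat M\in S_{\hat\rho}$; (ii) if $\hat\rho/\check\rho\in 2\mathbb{N}_1$, then $R(I(\hat M))=B_{\hat\rho}(\hat M)\cap\Delta_{\hat\rho}$ for all $\hat M\in S_{\hat\rho}$.
   Context: $\mathbb{N}_1=\{1,2,3,\ldots\}$. $\mathbb{R}^m$ carries the maximum norm $\|x\|_\infty=\max_{1\le j\le m}|x_j|$. For a point $x\in\mathbb{R}^m$ and nonempty $A\subset\mathbb{R}^m$, $\mathrm{d}(x,A)=\inf_{y\in A}\|x-y\|_\infty$. For $\delta>0$, $B_\delta(A)=\{x\in\mathbb{R}^m:\mathrm{d}(x,A)\le\delta\}$. For $\rho>0$: $\Delta_\rho=\rho\mathbb{Z}^m$ and $S_\rho=\{M\subset\Delta_\rho:M\neq\emptyset\}$. *)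

(* Defs.v *)
From mathcomp Require Import all_boot all_order all_algebra.
From mathcomp Require Import all_classical all_reals all_analysis.
Import Order.TTheory GRing.Theory Num.Theory.
Import numFieldNormedType.Exports.

Set Implicit Arguments.
Unset Strict Implicit.
Unset Printing Implicit Defensive.

Local Open Scope classical_set_scope.
Local Open Scope ring_scope.

(* Points of R^m are row vectors; their norm `|x| is the matrix norm [mx_norm],
   that is, the maximum norm. *)

(* Only meaningful for nonempty A: [inf set0] is 0. *)
Definition dist_set (R : realType) (m : nat) (x : 'rV[R]_m)
    (A : set 'rV[R]_m) : R :=
  inf [set `|x - y| | y in A].

Definition nbhd_set (R : realType) (m : nat) (delta : R)
    (A : set 'rV[R]_m) : set 'rV[R]_m :=
  [set x | dist_set x A <= delta].

Definition grid (R : realType) (m : nat) (rho : R) : set 'rV[R]_m :=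
  [set rho *: map_mx intr z | z in [set: 'rV[int]_m]].

Definition grid_subsets (R : realType) (m : nat) (rho : R) :
    set (set 'rV[R]_m) :=
  [set M | M `<=` grid rho /\ M !=set0].

(* Restriction of a fine-grid set to the coarse grid of mesh [rhoh]. It does
   not depend on the mesh of the fine grid. *)
Definition restriction (R : realType) (m : nat) (rhoh : R)
    (M : set 'rV[R]_m) : set 'rV[R]_m :=
  nbhd_set (rhoh / 2) M `&` grid rhoh.

(* Interpolation of a set in the coarse grid of mesh [rhoh] to the fine grid
   of mesh [rhoc]. *)
Definition interpolation (R : realType) (m : nat) (rhoc rhoh : R)
    (M : set 'rV[R]_m) : set 'rV[R]_m :=
  nbhd_set (rhoh / 2) M `&` grid rhoc.

(* Main.v *)
Require Import Defs.
From mathcomp Require Import all_boot all_order all_algebra.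
From mathcomp Require Import all_classical all_reals all_analysis.
From mathcomp Require Import ring lra.
Import Order.TTheory GRing.Theory Num.Theory.
Import numFieldNormedType.Exports.

(** Write rhoh = n rhoc. All points involved lie in the fine grid, where distances
    are natural multiples of the mesh ([grid_norm]), so being at distance at most
    d from a set means being at distance at most d from one of its points
    ([nbhd_set_attained]). Hence x belongs to R(I(M)) exactly when x is a coarse
    point for which there are y in M and z in the fine grid with |x - z| and
    |z - y| both at most rhoh / 2. By the triangle inequality |x - y| is then at
    most rhoh, and the parity of n decides whether equality can occur.

    If n = 2k + 1, a fine distance that is at most rhoh / 2 = (k + 1/2) rhoc is at
    most k rhoc, so |x - y| is at most 2k rhoc, which is less than rhoh. Distinct
    coarse points are at distance at least rhoh, so x = y, and R(I(M)) is
    contained in M. The other inclusion holds with x = z = y.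

    If n = 2k, coarse points x and y with |x - y| at most rhoh have a midpoint z,
    which lies in the fine grid ([grid_midpoint]) at distance at most rhoh / 2
    from both; so every coarse point within rhoh of M is in R(I(M)).

    The operators return nonempty sets: I(M) contains M, and every point of the
    space has a coarse point within rhoh / 2 ([grid_dense]). *)

Set Implicit Arguments.
Unset Strict Implicit.
Unset Printing Implicit Defensive.

Local Open Scope classical_set_scope.
Local Open Scope ring_scope.

(** Distances between points of a grid are quantized: the maximum norm picks
    one coordinate, and that coordinate is an integer multiple of the mesh.
    Everything discrete in the proof (attained infima, rounding down of bounds)
    comes from this. *)
Lemma grid_norm (R : realType) (m : nat) (rho : R) (x y : 'rV[R]_m) :
  0 <= rho -> grid rho x -> grid rho y -> exists k : nat, `|x - y| = rho * k%:R.
Proof.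
move=> rho0 [z _ <-] [w _ <-].
rewrite -scalerBr -map_mxB normrZ ger0_norm//.
set v := (X in `|X|).
have [v0|vN0] := eqVneq `|v| 0; first by exists 0; rewrite v0.
have [i vi] := mx_norm_neq0 vN0.
exists (absz ((z - w)%R i.1 i.2)); congr (_ * _).
by rewrite [LHS]vi mxE natr_absz intr_norm.
Qed.

Lemma sub_grid (R : realType) (m n : nat) (rho : R) :
  grid (n%:R * rho) `<=` @grid R m rho.
Proof.
move=> _ [z _ <-]; exists (z *+ n) => //.
by rewrite raddfMn -scaler_nat scalerA mulrC.
Qed.

Lemma mem_nbhd_set (R : realType) (m : nat) (d : R) (A : set 'rV[R]_m)
    (x y : 'rV[R]_m) :
  A y -> `|x - y| <= d -> nbhd_set d A x.
Proof.
move=> Ay; apply: le_trans; apply: ge_inf; last by exists y.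
by exists 0 => _ [w _ <-].
Qed.

(** The infimum in the distance is attained, because the distances occurring
    here lie in [rho * nat]: some distance is below the first multiple of
    [rho] exceeding [d], hence is at most the last multiple not exceeding
    [d]. *)
Lemma nbhd_set_attained (R : realType) (m : nat) (rho d : R)
    (A : set 'rV[R]_m) (x : 'rV[R]_m) :
  0 < rho -> 0 <= d -> grid_subsets rho A -> grid rho x -> nbhd_set d A x ->
  exists2 y, A y & `|x - y| <= d.
Proof.
move=> rho0 d0 [Agrid [a Aa]] gx xd.
have d_lt : d < rho * (Num.truncn (d / rho)).+1%:R.
  by rewrite mulrC -ltr_pdivrMr// truncnS_gt.
have [||_ [y Ay <-] xy] :=
  @inf_lt _ [set `|x - y| | y in A] (rho * (Num.truncn (d / rho)).+1%:R).
- by exists `|x - a|, a.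
- exact: le_lt_trans xd d_lt.
exists y => //; have [k xyk] := grid_norm (ltW rho0) gx (Agrid _ Ay).
move: xy; rewrite xyk ltr_pM2l// ltr_nat ltnS => k_le.
by rewrite mulrC -ler_pdivlMr// -truncn_ge_nat// divr_ge0// ltW.
Qed.

(** Rounding every coordinate to a nearest grid value; this makes the
    restriction of a nonempty set nonempty. *)
Lemma grid_dense (R : realType) (m : nat) (rho : R) (x : 'rV[R]_m) :
  0 < rho -> exists2 y, grid rho y & `|y - x| <= rho / 2.
Proof.
move=> rho0; pose z : 'rV[int]_m := \row_j Num.floor (x 0 j / rho + 2^-1).
exists (rho *: map_mx intr z); first by exists z.
rewrite [leLHS]/Num.norm /= mx_normrE; apply/bigmax_leP.
split=> [|[i j] _ /=]; first by lra.
rewrite (ord1 i) !mxE.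
have lo := floor_le (x 0 j / rho + 2^-1).
have hi := floorD1_gt (x 0 j / rho + 2^-1).
rewrite intrD in hi.
set f : R := (Num.floor _)%:~R in lo hi *.
have -> : x 0 j = rho * (x 0 j / rho) by field; rewrite gt_eqF.
rewrite -mulrBr normrM (gtr0_norm rho0) ler_pM2l//.
by rewrite ler_norml; apply/andP; split; lra.
Qed.

(** The coarse mesh being an even multiple of the fine one, the halves of
    coarse points are fine points. This is where parity enters. *)
Lemma grid_midpoint (R : realType) (m k : nat) (rho : R) (x y : 'rV[R]_m) :
  grid ((2 * k)%:R * rho) x -> grid ((2 * k)%:R * rho) y ->
  grid rho (2^-1 *: (x + y)).
Proof.
move=> [z _ <-] [w _ <-]; exists ((z + w) *+ k) => //.
rewrite raddfMn /= map_mxD -scaler_nat -scalerDr !scalerA natrM.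
by congr (_ *: _); field.
Qed.

Theorem theorem24 (R : realType) (m : nat) (hm : (0 < m)%N)
    (rhoc rhoh : R) (hrhoc : 0 < rhoc) (hrhoh : 0 < rhoh)
    (hn : exists2 n : nat, (2 <= n)%N & rhoh = n%:R * rhoc) :
  [/\ (forall M : set 'rV[R]_m,
         grid_subsets rhoc M -> grid_subsets rhoh (restriction rhoh M)),
      (forall M : set 'rV[R]_m,
         grid_subsets rhoh M ->
         grid_subsets rhoc (interpolation rhoc rhoh M)),
      ((exists2 k : nat, (1 <= k)%N & rhoh / rhoc = (2 * k + 1)%:R) ->
       forall M : set 'rV[R]_m, grid_subsets rhoh M ->
         restriction rhoh (interpolation rhoc rhoh M) = M)
    & ((exists2 k : nat, (1 <= k)%N & rhoh / rhoc = (2 * k)%:R) ->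
       forall M : set 'rV[R]_m, grid_subsets rhoh M ->
         restriction rhoh (interpolation rhoc rhoh M) =
         nbhd_set rhoh M `&` grid rhoh)].
Proof.
have [n _ rhohE] := hn.
have h0 : 0 <= rhoh / 2 by lra.
have gridS : grid rhoh `<=` @grid R m rhoc by rewrite rhohE; exact: sub_grid.
have subI (M : set 'rV[R]_m) : grid_subsets rhoh M ->
    M `<=` interpolation rhoc rhoh M.
  move=> [Mgrid _] x Mx; split; last exact/gridS/Mgrid.
  by apply: (mem_nbhd_set Mx); rewrite subrr normr0.
have IP (M : set 'rV[R]_m) : grid_subsets rhoh M ->
    grid_subsets rhoc (interpolation rhoc rhoh M).
  move=> MP; split=> [x []//|]; have [x Mx] := MP.2.
  by exists x; exact: subI.
(* A point of the composite is joined to M by two steps of length at most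
   rhoh / 2, with a stop in the fine grid. *)
have RIP (M : set 'rV[R]_m) x : grid_subsets rhoh M ->
    restriction rhoh (interpolation rhoc rhoh M) x ->
    exists y z, [/\ M y, grid rhoc z, `|x - z| <= rhoh / 2
                  & `|z - y| <= rhoh / 2].
  move=> MP [xI /gridS gx].
  have [z [zM gz] xz] := nbhd_set_attained hrhoc h0 (IP _ MP) gx xI.
  have MP' : grid_subsets rhoc M by split; [exact: subset_trans MP.1 _|exact: MP.2].
  have [y My zy] := nbhd_set_attained hrhoc h0 MP' gz zM.
  by exists y, z.
split=> //.
- move=> M [Mgrid [x Mx]]; split=> [y []//|].
  have [y gy yx] := grid_dense x hrhoh.
  by exists y; split=> //; exact: mem_nbhd_set yx.
- move=> [k _ kE] M MP; apply/seteqP; split=> [x xRI|x Mx]; last first.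
    split; last exact: MP.1.
    by apply: (mem_nbhd_set (subI _ MP _ Mx)); rewrite subrr normr0.
  have [y [z [My gz xz zy]]] := RIP _ _ MP xRI.
  have rhohk : rhoh = (2 * k%:R + 1) * rhoc.
    by rewrite -natrM natr1 -addn1 -kE divfK ?gt_eqF.
  (* Half an odd number of fine meshes is not attained as a distance in the fine
     grid, so each step is shorter than rhoh / 2 by half a fine mesh. *)
  have step u v : grid rhoc u -> grid rhoc v -> `|u - v| <= rhoh / 2 ->
      `|u - v : 'rV[R]_m| <= rhoc * k%:R.
    move=> gu gv; have [j ->] := grid_norm (ltW hrhoc) gu gv => jle.
    rewrite ler_pM2l// ler_nat -ltnS -(ltr_nat R) -(ltr_pM2l hrhoc) -natr1.
    by rewrite rhohk in jle; nra.
  have [i xyi] := grid_norm (ltW hrhoh) xRI.2 (MP.1 _ My).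
  (* The two coarse points x and y are then less than one coarse mesh apart. *)
  have lt1 : rhoh * i%:R < rhoh * 1.
    rewrite -xyi mulr1 (le_lt_trans (ler_distD z x y))//.
    have := step _ _ (gridS _ xRI.2) gz xz.
    have := step _ _ gz (gridS _ (MP.1 _ My)) zy.
    by rewrite rhohk; nra.
  move: lt1 xyi; rewrite ltr_pM2l// ltrn1 ltnS leqn0 => /eqP ->.
  by move/eqP; rewrite mulr0 normr_eq0 subr_eq0 => /eqP ->.
- move=> [k _ kE] M MP.
  have rhohk : rhoh = (2 * k)%:R * rhoc by rewrite -kE divfK ?gt_eqF.
  apply/seteqP; split=> x.
    move=> xRI; split; last exact: xRI.2.
    have [y [z [My gz xz zy]]] := RIP _ _ MP xRI.
    apply: (mem_nbhd_set My); rewrite (le_trans (ler_distD z x y))//.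
    by lra.
  move=> [xM gx]; split=> //.
  have [y My xy] := nbhd_set_attained hrhoh (ltW hrhoh) MP gx xM.
  have gy := MP.1 _ My.
  (* The midpoint of x and y is the stop in the fine grid. *)
  have half (u v : 'rV[R]_m) : `|u - 2^-1 *: (u + v)| = `|u - v| / 2.
    have -> : u - 2^-1 *: (u + v) = 2^-1 *: (u - v).
      by apply/rowP=> j; rewrite !mxE; field.
    by rewrite normrZ ger0_norm ?invr_ge0// mulrC.
  apply: (@mem_nbhd_set _ _ _ _ _ (2^-1 *: (x + y))); last by rewrite half; lra.
  split; first by apply: (mem_nbhd_set My); rewrite distrC (addrC x) half distrC; lra.
  by apply: (@grid_midpoint _ _ k); rewrite -rhohk.
Qed.
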